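(* Fix single-party measurements on $\mathbb C^2$ given by orthonormal bases $\{|a_i\rangle\}$, $\{|a'_i\rangle\}$, $\{|b_j\rangle\}$, $\{|b'_j\rangle\}$, and let $e_{AB},e_{AB'},e_{A'B},e_{A'B'}$ be four measurements on $\mathbb C^2\otimes\mathbb C^2$ (each given by an orthonormal basis $\{|p_{X_iY_j}\rangle\}_{i,j=1,2}$ of $\mathbb C^4$ with outcomes $\lambda_{X_iY_j}$), performed on a state given by a unit vector $|p\rangle$ (probabilities $p(\lambda_{X_iY_j})=|\langle p_{X_iY_j}|p\rangle|^2$). Call $e_{XY}$ product if $|p_{X_iY_j}\rangle=|x_i\rangle\otimes|y_j\rangle$ for all $i,j$, where $\{|x_i\rangle\}$, $\{|y_j\rangle\}$ are the fixed bases corresponding to $X$ and $Y$. If the marginal distribution law fails for each of the four pairs $(e_{AB},e_{AB'})$, $(e_{A'B},e_{A'B'})$, $(e_{AB},e_{A'B})$, $(e_{AB'},e_{A'B'})$, then at least two of the four measurements are not product (i.e. are entangled).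
   Context: Marginal distribution law: for coincidence measurements $e_{XY}$ ($X\in\{A,A'\}$, $Y\in\{B,B'\}$) with outcomes $\lambda_{X_iY_j}$, $i,j=1,2$, and probabilities $p(\lambda_{X_iY_j})$, the law holds for a pair $e_{XY},e_{XY'}$ sharing the first letter if $\sum_j p(\lambda_{X_iY_j})=\sum_j p(\lambda_{X_iY'_j})$ for $i=1,2$, and for a pair $e_{XY},e_{X'Y}$ sharing the second letter if $\sum_j p(\lambda_{X_jY_i})=\sum_j p(\lambda_{X'_jY_i})$ for $i=1,2$. *)

(* Defs.v *)
From HB Require Import structures.
From mathcomp Require Import all_boot all_order all_algebra.
Set Implicit Arguments. Unset Strict Implicit. Unset Printing Implicit Defensive.
Import Order.TTheory GRing.Theory Num.Theory.
Local Open Scope ring_scope.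

Section Defs.
Variable C : numClosedFieldType.

Definition vec2 := 'I_2 -> C.
(* vectors of C^2 (x) C^2 = C^4 : coordinates indexed by 'I_2 * 'I_2 *)
Definition vec4 := ('I_2 * 'I_2)%type -> C.

Definition dot2 (u v : vec2) : C := \sum_(k : 'I_2) (u k)^* * v k.
Definition dot4 (u v : vec4) : C := \sum_(k : 'I_2 * 'I_2) (u k)^* * v k.

Definition tensor (x y : vec2) : vec4 := fun kl => x kl.1 * y kl.2.

Definition onb2 (x : 'I_2 -> vec2) : Prop :=
  forall i i' : 'I_2, dot2 (x i) (x i') = (i == i')%:R.

Definition onb4 (e : 'I_2 -> 'I_2 -> vec4) : Prop :=
  forall i j i' j' : 'I_2, dot4 (e i j) (e i' j') = ((i == i') && (j == j'))%:R.

Definition prob (e : 'I_2 -> 'I_2 -> vec4) (p : vec4) (i j : 'I_2) : C :=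
  `|dot4 (e i j) p| ^+ 2.

(* marginal distribution law for e_{XY}, e_{XY'} (sharing the first letter) *)
Definition marginal_first (e f : 'I_2 -> 'I_2 -> vec4) (p : vec4) : Prop :=
  forall i : 'I_2, \sum_(j < 2) prob e p i j = \sum_(j < 2) prob f p i j.

(* marginal distribution law for e_{XY}, e_{X'Y} (sharing the second letter) *)
Definition marginal_second (e f : 'I_2 -> 'I_2 -> vec4) (p : vec4) : Prop :=
  forall i : 'I_2, \sum_(j < 2) prob e p j i = \sum_(j < 2) prob f p j i.

Definition is_product (e : 'I_2 -> 'I_2 -> vec4) (x y : 'I_2 -> vec2) : Prop :=
  forall i j : 'I_2, forall kl, e i j kl = tensor (x i) (y j) kl.

End Defs.

(* Main.v *)
(* If e_{XY} is the product measurement {|x_i> (x) |y_j>}, then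
   <x_i (x) y_j | p> = <y_j | q_i> where q_i = <x_i|_1 p is the partial inner
   product of p with |x_i> on the first factor.  Summing the outcome
   probabilities over j and using Parseval's identity for the orthonormal basis
   {|y_j>} gives the marginal <q_i|q_i>, which depends on X alone.  Hence two
   product measurements sharing the first letter satisfy the marginal law, and
   symmetrically for the second letter.

   The four pairs in the theorem form the 4-cycle AB - AB' - A'B' - A'B - AB;
   every violated marginal law forbids both ends of an edge to be product, and
   a 4-cycle has no independent set of three vertices, so at least two of the
   measurements are entangled. *)

From Stdlib Require Import Classical.
Require Import Defs.
From HB Require Import structures.
From mathcomp Require Import all_boot all_order all_algebra.
From mathcomp Require Import ring.
Import Order.TTheory GRing.Theory Num.Theory.
Set Implicit Arguments. Unset Strict Implicit. Unset Printing Implicit Defensive.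
Local Open Scope ring_scope.

Section ProductMarginals.
Variable C : numClosedFieldType.

(* Completeness of an orthonormal basis of C^2: the columns of a unitary
   matrix are orthonormal as soon as its rows are. *)
Lemma onb2_complete (b : 'I_2 -> vec2 C) : onb2 b ->
  forall k l : 'I_2, \sum_j b j l * (b j k)^* = (l == k)%:R.
Proof.
move=> Hb k l.
pose M : 'M[C]_2 := \matrix_(j, k) (b j k)^*.
pose N : 'M[C]_2 := \matrix_(k, j) b j k.
have MN1 : M *m N = 1%:M.
  apply/matrixP => i j; rewrite !mxE -(Hb i j) /dot2.
  by apply: eq_bigr => m _; rewrite !mxE.
have /matrixP /(_ l k) := mulmx1C MN1; rewrite !mxE => <-.
by apply: eq_bigr => m _; rewrite !mxE.
Qed.

Lemma parseval2 (b : 'I_2 -> vec2 C) (v : vec2 C) : onb2 b ->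
  \sum_j `|dot2 (b j) v| ^+ 2 = dot2 v v.
Proof.
move=> Hb.
have expand j : `|dot2 (b j) v| ^+ 2 =
    \sum_k \sum_l (v k)^* * v l * (b j k * (b j l)^*).
  rewrite normCKC /dot2 rmorph_sum mulr_suml; apply: eq_bigr => k _.
  rewrite mulr_sumr; apply: eq_bigr => l _; rewrite rmorphM /= conjCK; ring.
under eq_bigr => j _ do rewrite expand.
rewrite exchange_big /dot2; apply: eq_bigr => k _.
rewrite exchange_big (bigD1 k) //= -mulr_sumr onb2_complete // eqxx mulr1.
rewrite big1 ?addr0 // => l Hlk.
by rewrite -mulr_sumr onb2_complete // eq_sym (negbTE Hlk) mulr0.
Qed.

Definition contract_first (u : vec2 C) (p : vec4 C) : vec2 C :=
  fun l => \sum_k (u k)^* * p (k, l).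
Definition contract_second (u : vec2 C) (p : vec4 C) : vec2 C :=
  fun k => \sum_l (u l)^* * p (k, l).

Lemma dot4_tensor_first (u v : vec2 C) (p : vec4 C) :
  dot4 (tensor u v) p = dot2 v (contract_first u p).
Proof.
rewrite /dot4 /dot2 /tensor /contract_first.
under [RHS]eq_bigr => l _ do rewrite mulr_sumr.
rewrite exchange_big /= (pair_bigA _ (fun k l => (v l)^* * ((u k)^* * p (k, l)))).
by apply: eq_bigr => [[k l]] _ /=; rewrite rmorphM /=; ring.
Qed.

Lemma dot4_tensor_second (u v : vec2 C) (p : vec4 C) :
  dot4 (tensor u v) p = dot2 u (contract_second v p).
Proof.
rewrite /dot4 /dot2 /tensor /contract_second.
under [RHS]eq_bigr => k _ do rewrite mulr_sumr.
rewrite (pair_bigA _ (fun k l => (u k)^* * ((v l)^* * p (k, l)))).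
by apply: eq_bigr => [[k l]] _ /=; rewrite rmorphM /=; ring.
Qed.

Lemma prob_product (e : 'I_2 -> 'I_2 -> vec4 C) (x y : 'I_2 -> vec2 C)
    (p : vec4 C) (i j : 'I_2) :
  is_product e x y -> prob e p i j = `|dot4 (tensor (x i) (y j)) p| ^+ 2.
Proof. by move=> He; rewrite /prob /dot4; under eq_bigr => kl _ do rewrite He. Qed.

Lemma product_marginal_first (e : 'I_2 -> 'I_2 -> vec4 C)
    (x y : 'I_2 -> vec2 C) (p : vec4 C) (i : 'I_2) :
  onb2 y -> is_product e x y ->
  \sum_(j < 2) prob e p i j =
    dot2 (contract_first (x i) p) (contract_first (x i) p).
Proof.
move=> Hy He; under eq_bigr => j _ do rewrite (prob_product p i j He).
by under eq_bigr => j _ do rewrite dot4_tensor_first; rewrite parseval2.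
Qed.

Lemma product_marginal_second (e : 'I_2 -> 'I_2 -> vec4 C)
    (x y : 'I_2 -> vec2 C) (p : vec4 C) (i : 'I_2) :
  onb2 x -> is_product e x y ->
  \sum_(j < 2) prob e p j i =
    dot2 (contract_second (y i) p) (contract_second (y i) p).
Proof.
move=> Hx He; under eq_bigr => j _ do rewrite (prob_product p j i He).
by under eq_bigr => j _ do rewrite dot4_tensor_second; rewrite parseval2.
Qed.

Lemma products_marginal_first (e f : 'I_2 -> 'I_2 -> vec4 C)
    (x y y' : 'I_2 -> vec2 C) (p : vec4 C) :
  onb2 y -> onb2 y' -> is_product e x y -> is_product f x y' ->
  marginal_first e f p.
Proof.
move=> Hy Hy' He Hf i.
by rewrite (product_marginal_first p i Hy He) (product_marginal_first p i Hy' Hf).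
Qed.

Lemma products_marginal_second (e f : 'I_2 -> 'I_2 -> vec4 C)
    (x x' y : 'I_2 -> vec2 C) (p : vec4 C) :
  onb2 x -> onb2 x' -> is_product e x y -> is_product f x' y ->
  marginal_second e f p.
Proof.
move=> Hx Hx' He Hf i.
by rewrite (product_marginal_second p i Hx He) (product_marginal_second p i Hx' Hf).
Qed.

End ProductMarginals.

(* A 4-cycle P1 - P2 - P4 - P3 - P1 has no independent set of size three:
   if no edge has both ends true, then at least two vertices are false. *)
Lemma cycle4_two_false (P1 P2 P3 P4 : Prop) :
  ~ (P1 /\ P2) -> ~ (P3 /\ P4) -> ~ (P1 /\ P3) -> ~ (P2 /\ P4) ->
  (~ P1 /\ ~ P2) \/ (~ P1 /\ ~ P3) \/ (~ P1 /\ ~ P4) \/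
  (~ P2 /\ ~ P3) \/ (~ P2 /\ ~ P4) \/ (~ P3 /\ ~ P4).
Proof.
by case: (classic P1); case: (classic P2); case: (classic P3);
  case: (classic P4); tauto.
Qed.

Theorem theorem4 (C : numClosedFieldType)
  (a a' b b' : 'I_2 -> vec2 C)
  (eAB eAB' eA'B eA'B' : 'I_2 -> 'I_2 -> vec4 C) (p : vec4 C) :
  onb2 a -> onb2 a' -> onb2 b -> onb2 b' ->
  onb4 eAB -> onb4 eAB' -> onb4 eA'B -> onb4 eA'B' ->
  dot4 p p = 1 ->
  ~ marginal_first eAB eAB' p ->
  ~ marginal_first eA'B eA'B' p ->
  ~ marginal_second eAB eA'B p ->
  ~ marginal_second eAB' eA'B' p ->
  (~ is_product eAB a b /\ ~ is_product eAB' a b') \/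
  (~ is_product eAB a b /\ ~ is_product eA'B a' b) \/
  (~ is_product eAB a b /\ ~ is_product eA'B' a' b') \/
  (~ is_product eAB' a b' /\ ~ is_product eA'B a' b) \/
  (~ is_product eAB' a b' /\ ~ is_product eA'B' a' b') \/
  (~ is_product eA'B a' b /\ ~ is_product eA'B' a' b').
Proof.
move=> Ha Ha' Hb Hb' _ _ _ _ _ NAB NA'B NA NB'.
apply: cycle4_two_false => [[P Q]|[P Q]|[P Q]|[P Q]].
- exact/NAB/(products_marginal_first p Hb Hb' P Q).
- exact/NA'B/(products_marginal_first p Hb Hb' P Q).
- exact/NA/(products_marginal_second p Ha Ha' P Q).
- exact/NB'/(products_marginal_second p Ha Ha' P Q).
Qed.
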